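(* Let $n\ge 3$ be odd. The maximally entangled state $\Phi_J=I_3$ (the $3\times 3$ identity matrix) of the bipartite regular $n$-gon system does not exhibit Hardy's nonlocality: there is no choice of measurements $\mathcal M_1=\{E_1^{A+},E_1^{A-}\}$, $\mathcal M_2=\{E_2^{A+},E_2^{A-}\}$ for Alice and $\mathcal N_1=\{E_1^{B+},E_1^{B-}\}$, $\mathcal N_2=\{E_2^{B+},E_2^{B-}\}$ for Bob, of the type described in the context, such that the joint probabilities computed on $\Phi_J$ satisfy simultaneously $$P(E_1^{A+},E_1^{B+})>0,\quad P(E_1^{A+},E_2^{B+})=0,\quad P(E_2^{A+},E_1^{B+})=0,\quad P(E_2^{A-},E_2^{B-})=0 .$$
   Context: Polygon model, $n$ odd. Let $r_n=\sqrt{\sec(\pi/n)}$. The elementary state space $\Omega_n$ is the convex hull in $\mathbb R^3$ of the pure states $\omega_i=(r_n\cos\frac{2\pi i}{n},\,r_n\sin\frac{2\pi i}{n},\,1)^{\mathrm T}$, $i=1,\dots,n$. The unit effect is $u=(0,0,1)^{\mathrm T}$; the probability of an effect $e$ on a state $\omega$ is $e^{\mathrm T}\omega$, and the effects are all $e\in\mathbb R^3$ with $0\le e^{\mathrm T}\omega\le 1$ for all $\omega\in\Omega_n$. For odd $n$ the extremal effects other than $0$ and $u$ are $e_i=\frac{1}{1+r_n^2}(r_n\cos\frac{2\pi i}{n},\,r_n\sin\frac{2\pi i}{n},\,1)^{\mathrm T}$ and $\bar e_i=u-e_i$, $i=1,\dots,n$. Bipartite (maximal tensor product) states are the real $3\times3$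 matrices $\Phi$ with $u^{\mathrm T}\Phi u=1$ and $e^{\mathrm T}\Phi f\ge 0$ for all effects $e,f$. The joint probability of Alice's effect $E$ and Bob's effect $F$ on $\Phi$ is $P(E,F)=E^{\mathrm T}\Phi F$. Measurements used in Hardy's test: Alice's measurement $\mathcal M_1$ has effects $\{e_i,\bar e_i\}$ and $\mathcal M_2$ has effects $\{e_j,\bar e_j\}$ with $j\ne i$; Bob's $\mathcal N_1$ has effects $\{e_k,\bar e_k\}$ and $\mathcal N_2$ has effects $\{e_l,\bar e_l\}$ with $l\neq k$. In each measurement either of the two effects may be assigned the label $+$ (the other gets the label $-$). *)

(* Defs.v *)
From mathcomp Require Import all_boot all_order all_algebra.
From mathcomp Require Import all_classical all_reals all_analysis.
From mathcomp Require Import ring lra.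

Set Implicit Arguments.
Unset Strict Implicit.
Unset Printing Implicit Defensive.

Import Order.TTheory GRing.Theory Num.Theory.

Local Open Scope classical_set_scope.
Local Open Scope ring_scope.

Definition vec3 (R : realType) (x y z : R) : 'cV[R]_3 :=
  \col_(k < 3) [:: x; y; z]`_k.

(* [r_n ^ 2 = sec (pi / n)]; for [n >= 3] the secant is positive, so the
   truncation of [Num.sqrt] at negative arguments plays no role. *)
Definition polygon_radius (R : realType) (n : nat) : R :=
  Num.sqrt (cos (pi / n%:R))^-1.

Definition polygon_angle (R : realType) (n i : nat) : R :=
  2 * pi * i%:R / n%:R.

Definition pure_state (R : realType) (n i : nat) : 'cV[R]_3 :=
  vec3 (polygon_radius R n * cos (polygon_angle R n i))
       (polygon_radius R n * sin (polygon_angle R n i))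
       1.

Definition convex_hull (R : realType) (M : lmodType R) (A : set M) : set M :=
  smallest (@convex_set R M) A.

Definition state_space (R : realType) (n : nat) : set 'cV[R]_3 :=
  convex_hull [set pure_state R n i | i in [set i : nat | (1 <= i <= n)%N]].

Definition unit_effect (R : realType) : 'cV[R]_3 := vec3 0 0 1.

Definition prob (R : realType) (e w : 'cV[R]_3) : R := (e^T *m w) 0 0.

Definition is_effect (R : realType) (n : nat) (e : 'cV[R]_3) : Prop :=
  forall w, state_space n w -> 0 <= prob e w <= 1.

(* These are the nontrivial extremal effects only when [n] is odd. *)
Definition ext_effect (R : realType) (n i : nat) : 'cV[R]_3 :=
  (1 + polygon_radius R n ^+ 2)^-1 *:
    vec3 (polygon_radius R n * cos (polygon_angle R n i))
         (polygon_radius R n * sin (polygon_angle R n i))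
         1.

Definition ext_effect_bar (R : realType) (n i : nat) : 'cV[R]_3 :=
  unit_effect R - ext_effect R n i.

Definition joint_prob (R : realType) (Phi : 'M[R]_3) (E F : 'cV[R]_3) : R :=
  (E^T *m Phi *m F) 0 0.

Definition bipartite_state (R : realType) (n : nat) (Phi : 'M[R]_3) : Prop :=
  joint_prob Phi (unit_effect R) (unit_effect R) = 1 /\
  forall e f, is_effect n e -> is_effect n f -> 0 <= joint_prob Phi e f.

Definition max_entangled (R : realType) : 'M[R]_3 := 1%:M.

Record measurement (R : realType) := Measurement {
  eff_plus : 'cV[R]_3;
  eff_minus : 'cV[R]_3
}.

(* The labels [+] and [-] may be assigned to [e_i] and [u - e_i] either way. *)
Definition polygon_measurement (R : realType) (n i : nat) (M : measurement R) :
    Prop :=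
  (eff_plus M = ext_effect R n i /\ eff_minus M = ext_effect_bar R n i) \/
  (eff_plus M = ext_effect_bar R n i /\ eff_minus M = ext_effect R n i).

Definition hardy_settings (R : realType) (n : nat) (M1 M2 : measurement R) :
    Prop :=
  exists i j : nat,
    [/\ (1 <= i <= n)%N, (1 <= j <= n)%N, j <> i,
        polygon_measurement n i M1 & polygon_measurement n j M2].

Definition hardy_conditions (R : realType) (Phi : 'M[R]_3)
    (M1 M2 N1 N2 : measurement R) : Prop :=
  [/\ 0 < joint_prob Phi (eff_plus M1) (eff_plus N1),
      joint_prob Phi (eff_plus M1) (eff_plus N2) = 0,
      joint_prob Phi (eff_plus M2) (eff_plus N1) = 0
    & joint_prob Phi (eff_minus M2) (eff_minus N2) = 0].

Definition hardy_nonlocal (R : realType) (n : nat) (Phi : 'M[R]_3) : Prop :=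
  exists M1 M2 N1 N2 : measurement R,
    [/\ hardy_settings n M1 M2, hardy_settings n N1 N2
      & hardy_conditions Phi M1 M2 N1 N2].

Lemma joint_prob_max_entangled (R : realType) (e f : 'cV[R]_3) :
  joint_prob (max_entangled R) e f =
    e 0 0 * f 0 0 + e 1 0 * f 1 0 + e (inord 2) 0 * f (inord 2) 0.
Proof.
have i1 : lift ord0 ord0 = 1 :> 'I_3 by apply: val_inj.
have i2 : lift ord0 (lift ord0 ord0) = inord 2 :> 'I_3.
  by apply: val_inj; rewrite /= inordK.
by rewrite /joint_prob /max_entangled mulmx1 !mxE !big_ord_recl big_ord0 !mxE
  i1 i2 addr0 addrA.
Qed.

Section max_entangled_is_a_state.
Variables (R : realType) (n : nat).
Hypotheses (n3 : (3 <= n)%N) (nodd : odd n).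

Let th := polygon_angle R n.
Let r := polygon_radius R n.
Let d : R := pi / n%:R.
Let c := cos d.
Let s := sin d.
Let h := n./2.

Let n0 : n%:R != 0 :> R.
Proof. by rewrite pnatr_eq0 -lt0n (leq_trans _ n3). Qed.

Let nh : n%:R = 2 * h%:R + 1 :> R.
Proof. by rewrite -{1}(odd_double_half n) nodd natrD -mul2n natrM addrC. Qed.

Let d_bounds : 0 < d < pi / 2.
Proof.
have p := pi_gt0 R; have n3' : 3 <= n%:R :> R by rewrite ler_nat.
apply/andP; split; first by rewrite divr_gt0// (lt_le_trans _ n3').
by rewrite ltr_pM2l// ltf_pV2 ?posrE; lra.
Qed.

Let c0 : 0 < c.
Proof. by apply: cos_gt0_pihalf; have := d_bounds; have := pi_gt0 R; lra. Qed.

Let s0 : 0 < s.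
Proof. by apply: sin_gt0_pihalf; exact: d_bounds. Qed.

Let cs : c ^+ 2 + s ^+ 2 = 1. Proof. exact: cos2Dsin2. Qed.

Let r0 : 0 < r.
Proof. by rewrite sqrtr_gt0 invr_gt0. Qed.

Let r2 : r ^+ 2 * c = 1.
Proof. by rewrite sqr_sqrtr ?invr_ge0 ?(ltW c0)// mulVf// gt_eqF. Qed.

Let thD i j : th (i + j) = th i + th j.
Proof. by rewrite /th /polygon_angle natrD mulrDr mulrDl. Qed.

Let thn : th n = pi *+ 2.
Proof. by rewrite /th /polygon_angle mulfK// mulr_natl. Qed.

Let th1 : th 1 = d *+ 2.
Proof. by rewrite /th /polygon_angle /d; ring. Qed.

Let C1 : cos (th 1) = c ^+ 2 - s ^+ 2.
Proof. by rewrite th1 mulr2n cosD -!expr2. Qed.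

Let S1 : sin (th 1) = 2 * s * c.
Proof. by rewrite th1 mulr2n sinD -/c -/s; ring. Qed.

Let Cn i : cos (th (i + n)) = cos (th i).
Proof. by rewrite thD thn cosD2pi. Qed.

Let Sn i : sin (th (i + n)) = sin (th i).
Proof. by rewrite thD thn sinD2pi. Qed.

Let thh : th h.+1 = d + pi.
Proof.
rewrite /th /polygon_angle /d -[h.+1]addn1 natrD.
suff -> : 2 * pi * (h%:R + 1) = pi + pi * n%:R :> R by rewrite mulrDl mulfK.
by rewrite nh; ring.
Qed.

Let Ch : cos (th h.+1) = - c. Proof. by rewrite thh cosDpi. Qed.
Let Sh : sin (th h.+1) = - s. Proof. by rewrite thh sinDpi. Qed.

Let thmod (f : R -> R) (fP : forall i, f (th (i + n)) = f (th i)) i :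
  f (th (i %% n)) = f (th i).
Proof.
rewrite [in RHS](divn_eq i n) addnC; elim: (i %/ n)%N => [|k IH].
  by rewrite addn0.
by rewrite mulSn addnCA addnC fP.
Qed.

Let direction i x y := x * cos (th i) + y * sin (th i).

Let sector x y : exists m (al be : R), [/\ 0 <= al, 0 <= be,
  x = al * cos (th m) + be * cos (th (m + 1)) &
  y = al * sin (th m) + be * sin (th (m + 1))].
Proof.
have n_gt0 : (0 < n)%N by apply: leq_trans n3.
have [m0 m0P] : exists m, forall i, direction i x y <= direction m x y.
  have i0 : 'I_n := Ordinal n_gt0.
  case: (@arg_maxP _ _ _ i0 predT (fun i : 'I_n => direction i x y)) => //= m _ mP.
  exists m => i; have := mP (Ordinal (ltn_pmod i n_gt0)) isT.
  by rewrite /= /direction (thmod Cn) (thmod Sn).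
pose n' := n.-1.
have n'E : (n' + 1)%N = n by rewrite addn1 prednK.
have Cm : cos (th m0) = cos (th (m0 + n' + 1)) by rewrite -addnA n'E Cn.
have Sm : sin (th m0) = sin (th (m0 + n' + 1)) by rewrite -addnA n'E Sn.
have up := m0P (m0 + 1)%N; have dn := m0P (m0 + n')%N.
have thn' : th (m0 + n') = th m0 - th 1 + th n by rewrite -n'E !thD; ring.
have Cn' : cos (th (m0 + n')) =
    cos (th m0) * (c ^+ 2 - s ^+ 2) + sin (th m0) * (2 * s * c).
  by rewrite thn' thn cosD2pi cosB C1 S1.
have Sn' : sin (th (m0 + n')) =
    sin (th m0) * (c ^+ 2 - s ^+ 2) - cos (th m0) * (2 * s * c).
  by rewrite thn' thn sinD2pi sinB C1 S1.
have Cu : cos (th (m0 + 1)) =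
    cos (th m0) * (c ^+ 2 - s ^+ 2) - sin (th m0) * (2 * s * c).
  by rewrite thD cosD C1 S1.
have Su : sin (th (m0 + 1)) =
    sin (th m0) * (c ^+ 2 - s ^+ 2) + cos (th m0) * (2 * s * c).
  by rewrite thD sinD C1 S1.
have CS : cos (th m0) ^+ 2 + sin (th m0) ^+ 2 = 1 := cos2Dsin2 _.
rewrite /direction {}Cu {}Su in up *; rewrite /direction Cn' Sn' in dn.
pose p := x * cos (th m0) + y * sin (th m0).
pose q := y * cos (th m0) - x * sin (th m0).
have xE : x = p * cos (th m0) - q * sin (th m0).
  by rewrite -[LHS]mulr1 -CS /p /q; ring.
have yE : y = p * sin (th m0) + q * cos (th m0).
  by rewrite -[LHS]mulr1 -CS /p /q; ring.
have key (t : R) : p * (c ^+ 2 - s ^+ 2) + t * (2 * s * c) <= p -> t * c <= p * s.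
  have -> : p * (c ^+ 2 - s ^+ 2) = p - 2 * p * s ^+ 2.
    have c2 : c ^+ 2 = 1 - s ^+ 2 by rewrite -cs; ring.
    by rewrite c2; ring.
  move=> H; rewrite -(ler_pM2r s0) -(ler_pM2l (ltr0Sn R 1)).
  by move: H; rewrite expr2; lra.
have /key up' : p * (c ^+ 2 - s ^+ 2) + q * (2 * s * c) <= p.
  by apply: le_trans up; rewrite /p /q le_eqVlt; apply/orP; left; apply/eqP; ring.
have /key dn' : p * (c ^+ 2 - s ^+ 2) + (- q) * (2 * s * c) <= p.
  by apply: le_trans dn; rewrite /p /q le_eqVlt; apply/orP; left; apply/eqP; ring.
have sc0 : 0 < 2 * s * c by rewrite !mulr_gt0.
have scN0 : 2 * s * c != 0 by rewrite gt_eqF.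
have coef (t : R) : 0 <= t -> t * c <= p * s ->
    0 <= p - t * (c ^+ 2 - s ^+ 2) / (2 * s * c).
  move=> t0 tp; rewrite subr_ge0 ler_pdivrMr//.
  have : t * c * (2 * c) <= p * s * (2 * c) by rewrite ler_wpM2r// mulr_ge0// ltW.
  have : 0 <= t * (c ^+ 2 + s ^+ 2) by rewrite cs mulr1.
  lra.
case: (lerP 0 q) => q0.
  exists m0, (p - q * (c ^+ 2 - s ^+ 2) / (2 * s * c)), (q / (2 * s * c)).
  split; [exact: coef | by rewrite divr_ge0// ltW | |].
    rewrite thD cosD C1 S1 {1}xE; field.
    by rewrite (gt_eqF c0) (gt_eqF s0).
  rewrite thD sinD C1 S1 {1}yE; field.
  by rewrite (gt_eqF c0) (gt_eqF s0).
exists (m0 + n')%N, ((- q) / (2 * s * c)),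
  (p - (- q) * (c ^+ 2 - s ^+ 2) / (2 * s * c)).
have q0' : 0 <= - q by lra.
split; [by rewrite divr_ge0// ltW | exact: coef | |].
  rewrite -Cm Cn' {1}xE; field.
  by rewrite (gt_eqF c0) (gt_eqF s0).
rewrite -Sm Sn' {1}yE; field.
by rewrite (gt_eqF c0) (gt_eqF s0).
Qed.

Let effect_pure e i : is_effect n e ->
  0 <= r * direction i (e 0 0) (e 1 0) + e (inord 2) 0.
Proof.
move=> eP.
have n_gt0 : (0 < n)%N by apply: leq_trans n3.
have [j /andP[j1 jn] [cj sj]] : exists2 j, (1 <= j <= n)%N &
    cos (th j) = cos (th i) /\ sin (th j) = sin (th i).
  case: (posnP (i %% n)) => [i0|ip].
    exists n; first by rewrite n_gt0 leqnn.
    by rewrite -(thmod Cn i) -(thmod Sn i) i0 -(Cn 0) -(Sn 0) add0n.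
  exists (i %% n)%N; first by rewrite ip ltnW// ltn_pmod.
  by rewrite (thmod Cn) (thmod Sn).
have /eP/andP[+ _] : state_space n (pure_state R n j).
  by apply: sub_gen_smallest; exists j => //=; apply/andP.
rewrite (_ : prob e _ = joint_prob (max_entangled R) e (pure_state R n j)); last first.
  by rewrite /joint_prob /max_entangled mulmx1.
rewrite joint_prob_max_entangled !mxE /= inordK//= /direction -cj -sj -/r.
by move=> H; apply: le_trans H _; rewrite le_eqVlt; apply/orP; left; apply/eqP; rewrite /th; ring.
Qed.

Let effect_height e : is_effect n e -> exists m al be, [/\ 0 <= al, 0 <= be,
  e 0 0 = al * cos (th m) + be * cos (th (m + 1)),
  e 1 0 = al * sin (th m) + be * sin (th (m + 1)) &
  r * c * (al + be) <= e (inord 2) 0].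
Proof.
move=> eP; have [m [al [be [al0 be0 xE yE]]]] := sector (e 0 0) (e 1 0).
exists m, al, be; split=> //.
have := effect_pure (m + h.+1) eP.
suff -> : direction (m + h.+1) (e 0 0) (e 1 0) = - (c * (al + be)) by lra.
have CS : cos (th m) ^+ 2 = 1 - sin (th m) ^+ 2.
  by rewrite -(cos2Dsin2 (th m)); ring.
have s2 : s ^+ 2 = 1 - c ^+ 2 by rewrite -cs; ring.
rewrite /direction xE yE !thD !cosD !sinD Ch Sh C1 S1.
by ring: CS s2.
Qed.

Lemma max_entangled_state : bipartite_state n (max_entangled R).
Proof.
split; first by rewrite joint_prob_max_entangled !mxE /= inordK//=; ring.
move=> e f eP fP; rewrite joint_prob_max_entangled.
have [m [al [be [al0 be0 -> -> ez]]]] := effect_height eP.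
have fz : 0 <= f (inord 2) 0.
  have [m' [al' [be' [al0' be0' _ _]]]] := effect_height fP.
  by apply: le_trans; rewrite ?mulr_ge0 ?addr_ge0// ltW.
have f1 := effect_pure m fP; have f2 := effect_pure (m + 1) fP.
have rc0 : 0 <= r * c by rewrite mulr_ge0// ltW.
set z := e _ _ in ez *; set z' := f (inord 2) 0 in fz f1 f2 *.
have step (t D : R) : 0 <= t -> 0 <= r * D + z' -> - (t * (r * c) * z') <= t * D.
  move=> t0 H; have : 0 <= t * (r * c) * (r * D + z') by rewrite !mulr_ge0// ltW.
  have -> : t * (r * c) * (r * D + z') = t * (r ^+ 2 * c) * D + t * (r * c) * z'.
    by ring.
  by rewrite r2 mulr1; lra.
have g1 := step _ _ al0 f1; have g2 := step _ _ be0 f2.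
have g3 : r * c * (al + be) * z' <= z * z' by rewrite ler_wpM2r.
rewrite /direction in g1 g2; lra.
Qed.

End max_entangled_is_a_state.

(* Main.v *)
(** On [Phi_J = I_3] joint probabilities are inner products of effects, and
    with [t] the angle between [e_i] and [e_k] they satisfy
    [(1 + r^2)^2 P(e_i, ebar_k) = r^2 (1 - cos t)] and
    [(1 + r^2)^2 P(ebar_i, ebar_k) = r^2 (r^2 + cos t)], where
    [ebar_k = u - e_k].  So [P(e_i, ebar_k)] vanishes only for [i = k], and
    [P(ebar_i, ebar_k)] never vanishes because [r > 1].  Thus
    [P(A2-, B2-) = 0] forces one of [A2-], [B2-] to be some [e].  If exactly one
    is, then the settings 2 agree, and the other two zeros force setting 1
    of one party to equal its setting 2.  If both are, then the other two
    zeros give [A1+ = B2-] and [B1+ = A2-], so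
    [P(A1+, B1+) = P(B2-, A2-) = P(A2-, B2-) = 0]. *)

Require Import Defs.
From mathcomp Require Import all_boot all_order all_algebra.
From mathcomp Require Import all_classical all_reals all_analysis.
From mathcomp Require Import ring lra.

Import Order.TTheory GRing.Theory Num.Theory.

Local Open Scope ring_scope.

Lemma joint_prob_max_entangledC (R : realType) (e f : 'cV[R]_3) :
  joint_prob (max_entangled R) e f = joint_prob (max_entangled R) f e.
Proof. by rewrite !joint_prob_max_entangled; ring. Qed.

(** Half-angle formula: [1 - cos x = 2 * sin (x / 2) ^+ 2], and the sine is positive on the open
    interval from [0] to [pi]. *)
Lemma cos_lt1 (R : realType) (x : R) : 0 < x < 2 * pi -> cos x < 1.
Proof.
move=> xb; have s0 : 0 < sin (x / 2) by apply: sin_gt0_pi; lra.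
have -> : x = x / 2 + x / 2 by lra.
rewrite cosD; have := cos2Dsin2 (x / 2); have := mulr_gt0 s0 s0.
by rewrite !expr2; lra.
Qed.

Lemma polygon_radius_gt1 (R : realType) (n : nat) : (3 <= n)%N ->
  1 < polygon_radius R n.
Proof.
move=> n3; have p0 := pi_gt0 R; have n3' : 3 <= n%:R :> R by rewrite ler_nat.
have n0 : 0 < n%:R :> R by lra.
have d0 : 0 < pi / n%:R :> R by rewrite divr_gt0.
have d2 : pi / n%:R < pi / 2 :> R by rewrite ltr_pM2l// ltf_pV2 ?posrE; lra.
have c0 : 0 < cos (pi / n%:R : R) by apply: cos_gt0_pihalf; lra.
have c1 : cos (pi / n%:R : R) < 1 by apply: cos_lt1; lra.
rewrite /polygon_radius -[X in X < _](sqrtr1 R) ltr_sqrt ?invr_gt0//.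
by rewrite invf_gt1.
Qed.

(** Cosine is even, so [k < i] may be assumed; then [0 < i - k < n] puts the angle strictly between
    [0] and [2 * pi]. *)
Lemma cos_polygon_angle_sub_lt1 (R : realType) (n i k : nat) :
  (1 <= i <= n)%N -> (1 <= k <= n)%N -> i <> k ->
  cos (polygon_angle R n i - polygon_angle R n k) < 1.
Proof.
wlog ki : i k / (k < i)%N => [H ib kb ik|].
  have [ki|ik'|ki] := ltngtP k i; [exact: H| |by case: ik].
  by rewrite -cosN opprB; apply: H => // /esym.
move=> /andP[_ iLn] /andP[k1 _] _.
have n0 : 0 < n%:R :> R by rewrite ltr0n (leq_trans _ iLn)// (leq_trans _ ki).
have p0 := pi_gt0 R.
have -> : polygon_angle R n i - polygon_angle R n k =
    2 * pi * ((i - k)%:R / n%:R) :> R.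
  by rewrite natrB 1?ltnW// /polygon_angle; ring.
have x0 : 0 < (i - k)%:R / n%:R :> R by rewrite divr_gt0// ltr0n subn_gt0.
have x1 : (i - k)%:R / n%:R < 1 :> R.
  rewrite ltr_pdivrMr// mul1r ltr_nat (leq_trans _ iLn)//.
  by rewrite ltn_subrL k1 (leq_trans _ ki).
have pp : 0 < 2 * pi :> R by rewrite mulr_gt0.
by apply: cos_lt1; rewrite mulr_gt0//= gtr_pMr.
Qed.

Lemma joint_prob_ext_ext_bar (R : realType) (n i k : nat) :
  joint_prob (max_entangled R) (ext_effect R n i) (ext_effect_bar R n k) =
  (polygon_radius R n / (1 + polygon_radius R n ^+ 2)) ^+ 2 *
  (1 - cos (polygon_angle R n i - polygon_angle R n k)).
Proof.
rewrite joint_prob_max_entangled !mxE /= inordK//= cosB.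
by field; rewrite gt_eqF// ltr_wpDr// sqr_ge0.
Qed.

Lemma joint_prob_ext_bar_ext_bar (R : realType) (n i k : nat) :
  joint_prob (max_entangled R) (ext_effect_bar R n i) (ext_effect_bar R n k) =
  (polygon_radius R n / (1 + polygon_radius R n ^+ 2)) ^+ 2 *
  (polygon_radius R n ^+ 2 + cos (polygon_angle R n i - polygon_angle R n k)).
Proof.
rewrite joint_prob_max_entangled !mxE /= inordK//= cosB.
by field; rewrite gt_eqF// ltr_wpDr// sqr_ge0.
Qed.

(** With this common prefactor positive, a joint probability vanishes only if its trigonometric
    factor does. *)
Lemma polygon_weight_gt0 (R : realType) (n : nat) : (3 <= n)%N ->
  0 < (polygon_radius R n / (1 + polygon_radius R n ^+ 2)) ^+ 2.
Proof.
move=> /(polygon_radius_gt1 R) r1; have r0 := lt_trans ltr01 r1.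
by rewrite exprn_gt0// divr_gt0// addr_gt0// exprn_gt0.
Qed.

Lemma joint_prob_ext_ext_bar_eq0 (R : realType) (n i k : nat) : (3 <= n)%N ->
  (1 <= i <= n)%N -> (1 <= k <= n)%N ->
  joint_prob (max_entangled R) (ext_effect R n i) (ext_effect_bar R n k) = 0 ->
  i = k.
Proof.
move=> n3 ib kb; rewrite joint_prob_ext_ext_bar => H; apply: contrapT => ik.
have := mulr_gt0 (polygon_weight_gt0 R n n3).
move=> /(_ (1 - cos (polygon_angle R n i - polygon_angle R n k))).
by rewrite H ltxx subr_gt0 => /(_ (cos_polygon_angle_sub_lt1 R n i k ib kb ik)).
Qed.

Lemma joint_prob_ext_bar_ext_bar_neq0 (R : realType) (n i k : nat) :
  (3 <= n)%N ->
  joint_prob (max_entangled R) (ext_effect_bar R n i) (ext_effect_bar R n k) <> 0.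
Proof.
move=> n3; rewrite joint_prob_ext_bar_ext_bar; apply/eqP.
rewrite gt_eqF// mulr_gt0 ?polygon_weight_gt0//.
have r1 : 1 < polygon_radius R n ^+ 2.
  by rewrite expr_gt1 ?polygon_radius_gt1// ltW// (lt_trans ltr01)// polygon_radius_gt1.
have := cos_geN1 (polygon_angle R n i - polygon_angle R n k); lra.
Qed.

Theorem theorem1 (R : realType) (n : nat) (n_ge3 : (3 <= n)%N)
    (n_odd : odd n) : ~ hardy_nonlocal n (max_entangled R).
Proof.
move=> [M1 [M2 [N1 [N2 [[i [j [ib jb ji HM1 HM2]]]
  [k [l [kb lb lk HN1 HN2]]] [pos z12 z21 z22]]]]]].
have eb a b ab bb := joint_prob_ext_ext_bar_eq0 R n a b n_ge3 ab bb.
have be a b (ab : (1 <= a <= n)%N) (bb : (1 <= b <= n)%N) :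
    joint_prob (max_entangled R) (ext_effect_bar R n a) (ext_effect R n b) = 0 ->
    b = a by rewrite joint_prob_max_entangledC; apply: eb.
have bb0 a b := joint_prob_ext_bar_ext_bar_neq0 R n a b n_ge3.
move: pos z12 z21 z22.
(* Four labellings of the settings 2; in the first, both minus effects are complements [u - e]. *)
case: HM2 => [] [-> ->]; case: HN2 => [] [-> ->] pos z12 z21 z22.
- by case: (bb0 _ _ z22).
- have lj := be _ _ jb lb z22.
  (* The plus effect of [N2] is a complement, so that of [M1] cannot be one. *)
  case: HM1 => -[M1E _]; rewrite M1E in z12; last by case: (bb0 _ _ z12).
  by apply: ji; rewrite -lj (eb _ _ ib lb z12).
- have jl := eb _ _ jb lb z22.
  case: HN1 => -[N1E _]; rewrite N1E in z21; last by case: (bb0 _ _ z21).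
  by apply: lk; rewrite -jl (be _ _ jb kb z21).
- case: HM1 => -[M1E _]; rewrite M1E in z12 pos; last by case: (bb0 _ _ z12).
  case: HN1 => -[N1E _]; rewrite N1E in z21 pos; last by case: (bb0 _ _ z21).
  (* Now [i = l] and [k = j], so [pos] and [z22] concern the same pair of effects with the parties
     swapped. *)
  move: pos; rewrite (eb _ _ ib lb z12) (be _ _ jb kb z21).
  by rewrite joint_prob_max_entangledC z22 ltxx.
Qed.
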